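(* Let $\alpha\in(0,1]$ and suppose that the candidate-family process $\mathcal C=(\mathcal C_t)_{t\ge0}$ is setwise persistent. Then the following are equivalent: (i) for every $P\in\mathcal M$ and every deterministic time $t$, $\mathbb E_P[L_t^{\mathcal N(P)}(\mathcal C)]\le\alpha$; (ii) $\mathcal C$ controls simultaneous stopped FDR at level $\alpha$: for every $P\in\mathcal M$ and every $(\mathcal F_t)$-stopping time $\tau$ with $P(\tau<\infty)=1$, $\mathbb E_P[L_\tau^{\mathcal N(P)}(\mathcal C)]\le\alpha$; (iii) $\mathcal C$ controls simultaneous SupFDR at level $\alpha$: for every $P\in\mathcal M$, $\mathbb E_P[\sup_{t\ge0}L_t^{\mathcal N(P)}(\mathcal C)]\le\alpha$.
   Context: Let $(\Omega,\mathcal F,(\mathcal F_t)_{t\in\mathbb N_0})$ be a discrete-time filtered measurable space, $\mathcal M$ a family of probability measures on $(\Omega,\mathcal F)$, $\mathcal I\subseteq\mathbb N$ an index set (finite or infinite), and $H_i\subseteq\mathcal M$, $i\in\mathcal I$, null hypotheses. Put $\mathcal N(P)=\{i\in\mathcal I:P\in H_i\}$. The active sets $I_t\subseteq\mathcal I$ are deterministic and finite with $I_0\subseteq I_1\subseteq\cdots$ and $\bigcup_t I_t=\mathcal I$. For a finite $R\subseteq\mathcal I$ and any $S\subseteq\mathcal I$, $\mathrm{FDP}_S(R)=|S\cap R|/(|R|\vee 1)$. A candidate-family process $\mathcal C=(\mathcal C_t)_{t\ge0}$ consists of nonempty random families $\mathcal C_t\subseteq 2^{I_t}$ with $\{R\in\mathcal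 C_t\}\in\mathcal F_t$ for every deterministic $R\subseteq I_t$. It is setwise persistent if, pointwise on $\Omega$, $\mathcal C_t\subseteq\mathcal C_u$ whenever $t\le u$. Its current loss profile is $L_t^S(\mathcal C)=\max_{R\in\mathcal C_t}\mathrm{FDP}_{S\cap I_t}(R)$ for $S\subseteq\mathcal I$. *)

(* Defs.v *)
From HB Require Import structures.
From mathcomp Require Export all_boot all_order all_algebra.
From mathcomp Require Export finmap.
From mathcomp Require Export all_classical all_reals all_analysis.

Set Implicit Arguments.
Unset Strict Implicit.
Unset Printing Implicit Defensive.

Import Order.TTheory GRing.Theory Num.Theory.

Local Open Scope classical_set_scope.
Local Open Scope ring_scope.

Definition is_filtration (d : measure_display) (T : measurableType d)
    (F : nat -> set (set T)) : Prop :=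
  [/\ forall t, sigma_algebra [set: T] (F t),
      forall t, F t `<=` measurable &
      forall t u, (t <= u)%N -> F t `<=` F u].

(* [None] stands for the value infinity. *)
Definition stopping_time (d : measure_display) (T : measurableType d)
    (F : nat -> set (set T)) (tau : T -> option nat) : Prop :=
  forall t : nat, F t [set w | exists2 s : nat, tau w = Some s & (s <= t)%N].

Definition active_sets (I : set nat) (It : nat -> {fset nat}) : Prop :=
  (forall t u, (t <= u)%N -> (It t `<=` It u)%fset) /\
  \bigcup_t [set` It t] = I.

Definition true_nulls (d : measure_display) (T : measurableType d)
    (R : realType) (I : set nat) (H : nat -> set (probability T R))
    (P : probability T R) : set nat :=
  [set i | I i /\ H i P].

Definition FDP (R : realType) (S : set nat) (A : {fset nat}) : R :=
  #|` [fset i in A | i \in S]%fset|%:R / (maxn #|` A| 1)%:R.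

Definition candidate_family_process (d : measure_display)
    (T : measurableType d) (F : nat -> set (set T)) (It : nat -> {fset nat})
    (C : nat -> T -> {fset {fset nat}}) : Prop :=
  [/\ forall t w, C t w != fset0,
      forall t w, (C t w `<=` fpowerset (It t))%fset &
      forall t (A : {fset nat}), (A `<=` It t)%fset ->
        F t [set w | A \in C t w]].

Definition setwise_persistent (T : Type)
    (C : nat -> T -> {fset {fset nat}}) : Prop :=
  forall t u w, (t <= u)%N -> (C t w `<=` C u w)%fset.

(* The default value 0 of the maximum is harmless: [FDP] is nonnegative and
   candidate families are nonempty. *)
Definition loss (R : realType) (T : Type) (It : nat -> {fset nat})
    (C : nat -> T -> {fset {fset nat}}) (S : set nat) (t : nat) (w : T) : R :=
  \big[Num.max/0]_(A <- C t w) FDP R (S `&` [set` It t]) A.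

(* The value 0 on [tau = infinity] is immaterial: stopped losses are only
   integrated for almost surely finite stopping times. *)
Definition stopped_loss (R : realType) (T : Type) (It : nat -> {fset nat})
    (C : nat -> T -> {fset {fset nat}}) (S : set nat) (tau : T -> option nat)
    (w : T) : R :=
  if tau w is Some t then loss R It C S t w else 0.

(* Losses lie in [0, 1], so this real supremum is that of a nonempty bounded
   set. *)
Definition sup_loss (R : realType) (T : Type) (It : nat -> {fset nat})
    (C : nat -> T -> {fset {fset nat}}) (S : set nat) (w : T) : R :=
  sup [set loss R It C S t w | t in [set: nat]].

Definition fixed_time_control (d : measure_display) (T : measurableType d)
    (R : realType) (M : set (probability T R)) (I : set nat)
    (H : nat -> set (probability T R)) (It : nat -> {fset nat})
    (C : nat -> T -> {fset {fset nat}}) (alpha : R) : Prop :=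
  forall P : probability T R, M P -> forall t : nat,
    ('E_P[loss R It C (true_nulls I H P) t] <= alpha%:E)%E.

Definition stopped_FDR_control (d : measure_display) (T : measurableType d)
    (R : realType) (F : nat -> set (set T)) (M : set (probability T R))
    (I : set nat) (H : nat -> set (probability T R)) (It : nat -> {fset nat})
    (C : nat -> T -> {fset {fset nat}}) (alpha : R) : Prop :=
  forall P : probability T R, M P ->
  forall tau : T -> option nat, stopping_time F tau ->
    P [set w | tau w <> None] = 1%E ->
    ('E_P[stopped_loss R It C (true_nulls I H P) tau] <= alpha%:E)%E.

Definition SupFDR_control (d : measure_display) (T : measurableType d)
    (R : realType) (M : set (probability T R)) (I : set nat)
    (H : nat -> set (probability T R)) (It : nat -> {fset nat})
    (C : nat -> T -> {fset {fset nat}}) (alpha : R) : Prop :=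
  forall P : probability T R, M P ->
    ('E_P[sup_loss R It C (true_nulls I H P)] <= alpha%:E)%E.

(* Main.v *)
Require Import Defs.
From mathcomp Require Import measurable_realfun.
Import Order.TTheory GRing.Theory Num.Theory.
Local Open Scope classical_set_scope.
Local Open Scope ring_scope.

(** Restricting the nulls to [It t] is invisible to a candidate contained in
    [It t], so the false discovery proportion of a fixed candidate never changes
    once the candidate is available.  Under setwise persistence the loss at time
    [t] is therefore a maximum over a family that only grows with [t], and each
    loss path is nondecreasing ([loss_nondecreasing]).

    A nondecreasing path bounded by 1 converges to its supremum, so by monotone
    convergence the expected losses at deterministic times converge to the
    expected supremum ([cvg_expectation_loss]): a bound valid at every fixed time
    passes to the limit, which turns fixed-time control into SupFDR control.
    Conversely the supremum dominates the stopped loss pathwise, and deterministic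
    times are stopping times; hence SupFDR control implies stopped control, which
    implies fixed-time control. *)

Lemma FDP_le1 (R : realType) (S : set nat) (A : {fset nat}) : FDP R S A <= 1.
Proof.
rewrite ler_pdivrMr ?mul1r ?ltr0n ?leq_max ?orbT// ler_nat leq_max.
by rewrite fsubset_leq_card// fset_sub.
Qed.

Lemma FDP_setI (R : realType) (S : set nat) (J A : {fset nat}) :
  (A `<=` J)%fset -> FDP R (S `&` [set` J]) A = FDP R S A.
Proof.
move=> /fsubsetP AJ; rewrite /FDP; congr (_%:R / _).
congr (#|` _|); apply/fsetP => i; rewrite !inE/=.
have [iA|//] := boolP (i \in A); rewrite /= in_setI.
by rewrite [X in _ && X]mem_set ?andbT//=; exact: AJ.
Qed.

Section loss_paths.
Context {d : measure_display} {T : measurableType d} {R : realType}.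
Variables (It : nat -> {fset nat}) (C : nat -> T -> {fset {fset nat}}).
Variable S : set nat.
Hypothesis subC : forall t w, (C t w `<=` fpowerset (It t))%fset.

Lemma loss_ge0 t w : 0 <= loss R It C S t w.
Proof. exact: bigmax_ge_id. Qed.

Lemma loss_le1 t w : loss R It C S t w <= 1.
Proof. by apply: bigmax_le => // A _; exact: FDP_le1. Qed.

Lemma lossE t w : loss R It C S t w = \big[Num.max/0]_(A <- C t w) FDP R S A.
Proof.
rewrite /loss !big_seq; apply: eq_bigr => A AC; apply: FDP_setI.
by rewrite -fpowersetE; exact: (fsubsetP (subC t w)).
Qed.

(** Dropping the restriction to the active set leaves a summand that does not
    depend on time, so that only the growth of the family matters. *)
Lemma loss_nondecreasing w : setwise_persistent C ->
  nondecreasing_seq (loss R It C S ^~ w).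
Proof.
move=> persC t u tu; rewrite !lossE [leLHS]big_seq.
apply: bigmax_le => [|A AC]; first exact: bigmax_ge_id.
by apply: le_bigmax_seq => //; exact: (fsubsetP (persC t u w tu)).
Qed.

Lemma has_ubound_loss w : has_ubound (range (loss R It C S ^~ w)).
Proof. by exists 1 => _ [t _ <-]; exact: loss_le1. Qed.

Lemma loss_le_sup_loss t w : loss R It C S t w <= sup_loss R It C S w.
Proof. by apply: ub_le_sup; [exact: has_ubound_loss|exists t]. Qed.

Lemma sup_loss_ge0 w : 0 <= sup_loss R It C S w.
Proof. exact: le_trans (loss_ge0 0 w) (loss_le_sup_loss 0 w). Qed.

(** Where the time is infinite the stopped loss is 0, which is below the supremum
    because losses are nonnegative. *)
Lemma stopped_loss_le_sup_loss tau w :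
  0 <= stopped_loss R It C S tau w <= sup_loss R It C S w.
Proof.
rewrite /stopped_loss; case: (tau w) => [t|]; last by rewrite lexx sup_loss_ge0.
by rewrite loss_ge0 loss_le_sup_loss.
Qed.

(** The random index family is replaced by the deterministic [fpowerset (It t)],
    each candidate contributing only on the event that it is available. *)
Lemma measurable_loss t :
  (forall A : {fset nat}, (A `<=` It t)%fset -> measurable [set w | A \in C t w]) ->
  measurable_fun [set: T] (loss R It C S t).
Proof.
move=> mC.
pose avail A w : R := if A \in C t w then FDP R S A else 0.
have -> : loss R It C S t =
    fun w => \big[Num.max/0]_(A <- fpowerset (It t)) avail A w.
  apply/funext => w; rewrite lossE; apply/le_anti/andP; split.
    rewrite big_seq; apply: bigmax_le => [|A AC]; first exact: bigmax_ge_id.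
    have -> : FDP R S A = avail A w by rewrite /avail AC.
    apply: (le_bigmax_seq _ A xpredT (avail^~ w)) => //.
    exact: (fsubsetP (subC t w)).
  apply: bigmax_le => [|A _]; first exact: bigmax_ge_id.
  rewrite /avail; case: ifPn => AC; last exact: bigmax_ge_id.
  exact: le_bigmax_seq.
suff mmax (s : seq {fset nat}) : {subset s <= fpowerset (It t)} ->
    measurable_fun [set: T] (fun w => \big[Num.max/0]_(A <- s) avail A w).
  exact: mmax.
elim: s => [_|A s IH subs].
  under eq_fun do rewrite big_nil.
  exact: measurable_cst.
under eq_fun do rewrite big_cons.
apply: measurable_maxr; last first.
  by apply: IH => B Bs; apply: subs; rewrite inE Bs orbT.
apply: measurable_fun_ifT => //.
apply: (measurable_fun_bool true); rewrite setTI.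
apply: mC; rewrite -fpowersetE; apply: subs; exact: mem_head.
Qed.

End loss_paths.

(** The integral of a nonnegative function is a supremum over the simple
    functions below it, and [Y] has at least those that [X] has. *)
Lemma ge0_expectation_le (d : measure_display) (T : measurableType d)
    (R : realType) (P : probability T R) (X Y : T -> R) :
  (forall w, 0 <= X w <= Y w) -> ('E_P[X] <= 'E_P[Y])%E.
Proof.
move=> XY.
have X0 w : (0 <= (X w)%:E)%E by rewrite lee_fin; case/andP: (XY w).
have XleY w : ((X w)%:E <= (Y w)%:E)%E by rewrite lee_fin; case/andP: (XY w).
have Y0 w : (0 <= (Y w)%:E)%E by rewrite (le_trans (X0 w)).
rewrite unlock (ge0_integralTE _ X0) (ge0_integralTE _ Y0).
apply: le_ereal_sup => _ [h hX <-]; exists h => // w.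
exact: le_trans (hX w) (XleY w).
Qed.

(** Monotone convergence along the nondecreasing loss paths. *)
Lemma cvg_expectation_loss (d : measure_display) (T : measurableType d)
    (R : realType) (F : nat -> set (set T)) (It : nat -> {fset nat})
    (C : nat -> T -> {fset {fset nat}}) (S : set nat) (P : probability T R) :
  is_filtration F -> candidate_family_process F It C -> setwise_persistent C ->
  ('E_P[loss R It C S t] @[t --> \oo] --> 'E_P[sup_loss R It C S])%E.
Proof.
move=> [_ Fmeas _] [_ subC adaptC] persC; rewrite unlock.
have -> : (\int[P]_w (sup_loss R It C S w)%:E =
    \int[P]_w limn (fun t => (loss R It C S t w)%:E))%E.
  apply: eq_integral => w _; apply/esym/cvg_lim => //.
  apply: cvg_EFin; first exact: nearW.
  apply: nondecreasing_cvgn; last exact: has_ubound_loss.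
  exact: loss_nondecreasing.
apply: cvg_monotone_convergence => // [t|t w _|w _ t u tu].
- apply/measurable_EFinP/measurable_loss => // A AI.
  exact/Fmeas/adaptC.
- by rewrite lee_fin loss_ge0.
- by rewrite lee_fin; exact: loss_nondecreasing.
Qed.

Lemma stopping_time_cst (d : measure_display) (T : measurableType d)
    (F : nat -> set (set T)) (t : nat) :
  is_filtration F -> stopping_time F (fun=> Some t).
Proof.
move=> [sigF _ _] u; have [F0 FD _] := sigF u.
have [tu|ut] := leqP t u.
  rewrite [X in F u X](_ : _ = [set: T] `\` set0); first exact: FD.
  by rewrite setD0; apply/seteqP; split => // w _; exists t.
rewrite [X in F u X](_ : _ = set0)//; apply/seteqP; split => // w [s [<-]].
by rewrite leqNgt ut.
Qed.

Theorem proposition3p13 (d : measure_display) (Omega : measurableType d)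
    (R : realType) (F : nat -> set (set Omega))
    (M : set (probability Omega R)) (I : set nat)
    (H : nat -> set (probability Omega R)) (It : nat -> {fset nat})
    (C : nat -> Omega -> {fset {fset nat}}) (alpha : R)
    (filtF : is_filtration F)
    (HM : forall i, I i -> H i `<=` M)
    (actI : active_sets I It)
    (candC : candidate_family_process F It C)
    (alpha_gt0 : 0 < alpha) (alpha_le1 : alpha <= 1)
    (persC : setwise_persistent C) :
  (fixed_time_control M I H It C alpha <->
     stopped_FDR_control F M I H It C alpha) /\
  (stopped_FDR_control F M I H It C alpha <->
     SupFDR_control M I H It C alpha).
Proof.
have [_ subC _] := candC.
have fixed_sup : fixed_time_control M I H It C alpha ->
    SupFDR_control M I H It C alpha.
  move=> fixedC P MP.
  have cvgE := cvg_expectation_loss _ _ _ F It C (true_nulls I H P) P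
    filtF candC persC.
  apply: cvge_to_le cvgE _.
  by apply: nearW => t; exact: fixedC.
have sup_stopped : SupFDR_control M I H It C alpha ->
    stopped_FDR_control F M I H It C alpha.
  move=> supC P MP tau _ _; apply: le_trans (supC P MP).
  by apply: ge0_expectation_le => w; exact: stopped_loss_le_sup_loss.
have stopped_fixed : stopped_FDR_control F M I H It C alpha ->
    fixed_time_control M I H It C alpha.
  move=> stoppedC P MP t; apply: (stoppedC P MP (fun=> Some t)).
    exact: stopping_time_cst.
  rewrite [X in P X](_ : _ = [set: Omega]) ?probability_setT//.
  by apply/seteqP; split.
by split; split => h; auto.
Qed.
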